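(* Let $G$ be a group in the class $\mathfrak{C}$ and let $n\geq w(G)$. Then two normally generating $n$-tuples $U,V$ of $G$ are AC equivalent in $G$ if and only if their images are AC equivalent in the abelianization $\operatorname{Ab}(G)=G/[G,G]$. In other words, the connected components of the AC-graph $\Delta_n(G)$ are precisely the preimages (under the map induced by $G\to \operatorname{Ab}(G)$) of the connected components of the AC-graph $\Delta_n(\operatorname{Ab}(G))$.
   Context: $\mathfrak{C}$ is the class of finitely generated groups for which every maximal subgroup is normal (a maximal subgroup is a proper subgroup maximal among proper subgroups). For a group $G$, a tuple (or subset) is normally generating if the smallest normal subgroup of $G$ containing it is $G$. The weight $w(G)$ is the minimal number of normal generators of $G$. Tuples are $n$-tuples with $n\ge 1$. Elementary Nielsen moves on $G^n$ ($n\geq 1$) are, for $1\le i,j\le n$, $i\ne j$: $R_{ij}^{\pm}(x_1,\dots,x_n)$ replaces $x_i$ by $x_i x_j^{\pm1}$; $L_{ij}^{\pm}(x_1,\dots,x_n)$ replaces $x_i$ by $x_j^{\pm1}x_i$; $I_j(x_1,\dots,x_n)$ replaces $x_j$ by $x_j^{-1}$ (all other entries unchanged). Elementary Andrews-Curtis moves (AC-moves) are the elementary Nielsen moves together with the moves $AC_{i,s}$, $1\le i\le n$, $s\in G$, replacing $x_i$ by its conjugate $x_i^s$ and leaving the other entries unchanged. Two normally generating $n$-tuples are AC equivalent in $G$ if one is obtained from the other by a finite chain of AC-moves. For $n\ge w(G)$, the AC-graph $\Delta_n(G)$ has as vertices the normally generating $n$-tuples of $G$, two vertices being joined by an edge if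 one is obtained from the other by an AC-move. *)

(* Defs.v *)
From Stdlib Require Import Relation_Operators.
From HB Require Import structures.
From mathcomp Require Import all_boot.
From mathcomp Require Import boolp classical_sets cardinality.

Set Implicit Arguments.
Unset Strict Implicit.
Unset Printing Implicit Defensive.

Local Open Scope classical_set_scope.
Local Open Scope quotient_scope.
Local Open Scope group_scope.

Definition subgroup (G : groupType) (H : set G) : Prop :=
  [/\ H 1,
      forall x y, H x -> H y -> H (x * y)
    & forall x, H x -> H x^-1].

Definition normal_subgroup (G : groupType) (H : set G) : Prop :=
  subgroup H /\ forall x g, H x -> H (x ^ g).

Definition maximal_subgroup (G : groupType) (M : set G) : Prop :=
  [/\ subgroup M,
      M <> [set: G]
    & forall H : set G, subgroup H -> H <> [set: G] -> M `<=` H -> H = M].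

Definition finitely_generated (G : groupType) : Prop :=
  exists2 S : set G, finite_set S & smallest (@subgroup G) S = [set: G].

(* Usually denoted by a fraktur C. *)
Definition class_C (G : groupType) : Prop :=
  finitely_generated G /\
  forall M : set G, maximal_subgroup M -> normal_subgroup M.

Definition normally_generating (G : groupType) (n : nat) (U : n.-tuple G) :
    Prop :=
  smallest (@normal_subgroup G) [set x | x \in U] = [set: G].

Definition is_weight (G : groupType) (w : nat) : Prop :=
  (exists U : w.-tuple G, normally_generating U) /\
  forall m, (exists U : m.-tuple G, normally_generating U) -> (w <= m)%N.

(* The default value 0 is only used if no finite tuple normally generates G;
   by weightP this does not happen for finitely generated G. The trivial group
   has weight 0, the empty tuple being allowed here. *)
Definition weight (G : groupType) : nat := xget 0%N [set w | is_weight G w].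

Definition set_entry (T : Type) (n : nat) (U : n.-tuple T) (i : 'I_n) (y : T) :
    n.-tuple T :=
  [tuple if k == i then y else tnth U k | k < n].

Inductive nielsen_move (G : groupType) (n : nat) (U : n.-tuple G) :
    n.-tuple G -> Prop :=
| NielsenR i j of i != j :
    nielsen_move U (set_entry U i (tnth U i * tnth U j))
| NielsenRV i j of i != j :
    nielsen_move U (set_entry U i (tnth U i * (tnth U j)^-1))
| NielsenL i j of i != j :
    nielsen_move U (set_entry U i (tnth U j * tnth U i))
| NielsenLV i j of i != j :
    nielsen_move U (set_entry U i ((tnth U j)^-1 * tnth U i))
| NielsenI j :
    nielsen_move U (set_entry U j (tnth U j)^-1).

Inductive AC_move (G : groupType) (n : nat) (U : n.-tuple G) :
    n.-tuple G -> Prop :=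
| AC_nielsen V of nielsen_move U V : AC_move U V
| AC_conj i (s : G) : AC_move U (set_entry U i (tnth U i ^ s)).

(* AC-moves are invertible, so that following them in one direction already
   gives a symmetric relation (AC_equiv_sym). *)
Definition AC_equiv (G : groupType) (n : nat) (U V : n.-tuple G) : Prop :=
  clos_refl_trans (n.-tuple G) (@AC_move G n) U V.

Definition components (T : Type) (V : set T) (E : T -> T -> Prop) :
    set (set T) :=
  [set [set v | V v /\ clos_refl_trans T E u v] | u in V].

Definition AC_vertex (G : groupType) (n : nat) : set (n.-tuple G) :=
  [set U | normally_generating U].

Definition AC_edge (G : groupType) (n : nat) (U V : n.-tuple G) : Prop :=
  [/\ AC_vertex U, AC_vertex V & AC_move U V \/ AC_move V U].

Definition AC_components (G : groupType) (n : nat) : set (set (n.-tuple G)) :=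
  components (@AC_vertex G n) (@AC_edge G n).

Arguments AC_components G n : clear implicits.

Definition derived (G : groupType) : set G :=
  smallest (@subgroup G) [set c | exists x y : G, c = [~ x, y]].

Lemma derived_subgroup (G : groupType) : subgroup (@derived G).
Proof.
split=> [H [[]] //|x y Hx Hy H HS|x Hx H HS].
  by case: (HS) => -[_ HM _] _; apply: HM; [apply: Hx|apply: Hy].
by case: (HS) => -[_ _ HV] _; apply: HV; apply: Hx.
Qed.

Lemma derived_commg (G : groupType) (x y : G) : derived [~ x, y].
Proof. by move=> H [_]; apply; exists x, y. Qed.

Lemma derived_normal (G : groupType) : normal_subgroup (@derived G).
Proof.
have [_ DM _] := derived_subgroup G.
split=> [|x g Dx]; first exact: derived_subgroup.
have -> : x ^ g = x * [~ x, g] by rewrite /commg mulgA mulgV mul1g.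
exact: DM (derived_commg _ _).
Qed.

Definition ab_rel (G : groupType) (x y : G) : bool := `[< derived (x^-1 * y) >].

Lemma ab_rel_refl (G : groupType) : reflexive (@ab_rel G).
Proof. by move=> x; apply/asboolP; rewrite mulVg; case: (derived_subgroup G). Qed.

Lemma ab_rel_sym (G : groupType) : symmetric (@ab_rel G).
Proof.
have [_ _ DV] := derived_subgroup G.
move=> x y; apply/idP/idP => /asboolP /DV D; apply/asboolP;
  by rewrite invgM invgK in D.
Qed.

Lemma ab_rel_trans (G : groupType) : transitive (@ab_rel G).
Proof.
have [_ DM _] := derived_subgroup G.
move=> y x z /asboolP Dxy /asboolP Dyz; apply/asboolP.
by move: (DM _ _ Dxy Dyz); rewrite mulgA mulgK.
Qed.

Canonical ab_equiv (G : groupType) : equiv_rel G :=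
  EquivRel (@ab_rel G) (@ab_rel_refl G) (@ab_rel_sym G) (@ab_rel_trans G).

Definition Ab (G : groupType) : Type := {eq_quot (ab_equiv G)}.

HB.instance Definition _ (G : groupType) := Choice.on (Ab G).
HB.instance Definition _ (G : groupType) := EqQuotient.on (Ab G).

Definition ab (G : groupType) (x : G) : Ab G := \pi_(Ab G) x.

Lemma ab_eqP (G : groupType) (x y : G) : ab x = ab y <-> derived (x^-1 * y).
Proof.
split=> [/eqP|D]; first by rewrite eqmodE => /asboolP.
by apply/eqP; rewrite eqmodE; apply/asboolP.
Qed.

Definition ab_one (G : groupType) : Ab G := ab (1 : G).
Definition ab_inv (G : groupType) (a : Ab G) : Ab G := ab (repr a)^-1.
Definition ab_mul (G : groupType) (a b : Ab G) : Ab G := ab (repr a * repr b).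

Lemma ab_reprK (G : groupType) (a : Ab G) : ab (repr a) = a.
Proof. exact: reprK. Qed.

Lemma ab_mulE (G : groupType) (x y : G) : ab_mul (ab x) (ab y) = ab (x * y).
Proof.
apply/ab_eqP; have [_ DM _] := derived_subgroup G.
have [_ DJ] := derived_normal G.
have /ab_eqP Dx := ab_reprK (ab x); have /ab_eqP Dy := ab_reprK (ab y).
move: (repr (ab x)) (repr (ab y)) Dx Dy => u v Dx Dy.
suff -> : (u * v)^-1 * (x * y) = (u^-1 * x) ^ v * (v^-1 * y).
  by apply: DM => //; apply: DJ.
by rewrite /conjg invgM !mulgA mulgK.
Qed.

Lemma ab_invE (G : groupType) (x : G) : ab_inv (ab x) = ab x^-1.
Proof.
apply/ab_eqP; have [_ _ DV] := derived_subgroup G.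
have [_ DJ] := derived_normal G.
have /ab_eqP Dx := ab_reprK (ab x); move: (repr _) Dx => u Dx.
have -> : (u^-1)^-1 * x^-1 = ((u^-1 * x) ^ u^-1)^-1.
  by rewrite /conjg !invgM !invgK !mulgA mulgK.
exact: (DV _ (DJ _ _ Dx)).
Qed.

Lemma ab_mulA (G : groupType) : associative (@ab_mul G).
Proof.
move=> a b c; rewrite -(ab_reprK a) -(ab_reprK b) -(ab_reprK c) !ab_mulE.
by rewrite mulgA.
Qed.

Lemma ab_mul1 (G : groupType) : left_id (@ab_one G) (@ab_mul G).
Proof. by move=> a; rewrite -(ab_reprK a) ab_mulE mul1g. Qed.

Lemma ab_mul1r (G : groupType) : right_id (@ab_one G) (@ab_mul G).
Proof. by move=> a; rewrite -(ab_reprK a) ab_mulE mulg1. Qed.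

Lemma ab_mulV (G : groupType) : left_inverse (@ab_one G) (@ab_inv G) (@ab_mul G).
Proof. by move=> a; rewrite -(ab_reprK a) ab_invE ab_mulE mulVg. Qed.

Lemma ab_mulVr (G : groupType) :
  right_inverse (@ab_one G) (@ab_inv G) (@ab_mul G).
Proof. by move=> a; rewrite -(ab_reprK a) ab_invE ab_mulE mulgV. Qed.

HB.instance Definition _ (G : groupType) :=
  isGroup.Build (Ab G) (@ab_mulA G) (@ab_mul1 G) (@ab_mul1r G)
    (@ab_mulV G) (@ab_mulVr G).

Lemma abF (G : groupType) : {morph @ab G : x y / x / y}.
Proof.
move=> x y; change (ab (x / y) = ab_mul (ab x) (ab_inv (ab y))).
by rewrite ab_invE ab_mulE.
Qed.

HB.instance Definition _ (G : groupType) :=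
  isGroupMorphism.Build G (Ab G) (@ab G) (@abF G).

Definition ab_tuple (G : groupType) (n : nat) (U : n.-tuple G) :
    n.-tuple (Ab G) :=
  [tuple of map (@ab G) U].

(* The preimage under the map induced on vertices of the AC-graphs. *)
Definition ab_preimage (G : groupType) (n : nat) (C : set (n.-tuple (Ab G))) :
    set (n.-tuple G) :=
  [set U | AC_vertex U /\ C (ab_tuple U)].

Lemma weightP (G : groupType) :
  finitely_generated G -> is_weight G (weight G).
Proof.
move=> [S /finite_seqP [s ->] genS]; apply: xgetPex.
pose P k := `[< exists U : k.-tuple G, normally_generating U >].
have exP : exists k, P k.
  exists (size s); apply/asboolP; exists (in_tuple s).
  apply/seteqP; split=> // x _ H [[sH _] sub].
  suff : [set: G] x by rewrite -genS => /(_ H); apply.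
  by [].
case: (ex_minnP exP) => w /asboolP exw minw.
by exists w; split=> // m exm; apply: minw; apply/asboolP.
Qed.

Lemma tnth_set_entry (T : Type) (n : nat) (U : n.-tuple T) i y k :
  tnth (set_entry U i y) k = if k == i then y else tnth U k.
Proof. by rewrite tnth_mktuple. Qed.

Lemma set_entryK (T : Type) (n : nat) (U : n.-tuple T) i y z :
  z = tnth U i -> set_entry (set_entry U i y) i z = U.
Proof.
move=> ->; apply: eq_from_tnth => k; rewrite !tnth_set_entry.
by case: eqP => // ->.
Qed.

Lemma AC_move_sym (G : groupType) (n : nat) (U V : n.-tuple G) :
  AC_move U V -> AC_move V U.
Proof.
pose E := tnth_set_entry U.
have N i j y : i != j -> tnth (set_entry U i y) j = tnth U j.
  by rewrite E eq_sym => /negbTE ->.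
case=> [W [i j ij|i j ij|i j ij|i j ij|j]|i s]; set W' := set_entry _ _ _.
- have <- : set_entry W' i (tnth W' i * (tnth W' j)^-1) = U.
    by apply: set_entryK; rewrite /W' (N _ _ _ ij) E eqxx mulgK.
  by apply/AC_nielsen/NielsenRV.
- have <- : set_entry W' i (tnth W' i * tnth W' j) = U.
    by apply: set_entryK; rewrite /W' (N _ _ _ ij) E eqxx mulgVK.
  by apply/AC_nielsen/NielsenR.
- have <- : set_entry W' i ((tnth W' j)^-1 * tnth W' i) = U.
    by apply: set_entryK; rewrite /W' (N _ _ _ ij) E eqxx mulKg.
  by apply/AC_nielsen/NielsenLV.
- have <- : set_entry W' i (tnth W' j * tnth W' i) = U.
    by apply: set_entryK; rewrite /W' (N _ _ _ ij) E eqxx mulVKg.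
  by apply/AC_nielsen/NielsenL.
- have <- : set_entry W' j (tnth W' j)^-1 = U.
    by apply: set_entryK; rewrite /W' E eqxx invgK.
  by apply/AC_nielsen/NielsenI.
have <- : set_entry W' i (tnth W' i ^ s^-1) = U.
  by apply: set_entryK; rewrite /W' E eqxx conjgK.
exact: AC_conj.
Qed.

Lemma AC_equiv_sym (G : groupType) (n : nat) (U V : n.-tuple G) :
  AC_equiv U V -> AC_equiv V U.
Proof.
elim=> [A B /AC_move_sym AB|A|A B C _ BA _ CB]; first exact: rt_step.
  exact: rt_refl.
exact: rt_trans CB BA.
Qed.

(* Main.v *)
Require Import Defs.
From Stdlib Require Import Relation_Operators.
From mathcomp Require Import all_boot.
From mathcomp Require Import boolp classical_sets cardinality.

(* A normal maximal subgroup M contains [G, G]: for x outside M the centralizer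
   of x modulo M contains M and x, hence is G. So in the class C the derived
   subgroup lies in every maximal subgroup, and a tuple whose image normally
   generates Ab(G) generates G. AC-moves of Ab(G) lift to G, which leaves two
   generating tuples with the same image in Ab(G), whose entries can be corrected
   one at a time: the elements c such that x_i can be replaced by x_i c form a
   normal subgroup containing the other entries; modulo that subgroup G is
   generated by x_i alone, hence abelian, so c may be any element of [G, G]. *)

Local Open Scope classical_set_scope.
Local Open Scope group_scope.

(** * Maximal subgroups of finitely generated groups *)

(** Of two members of the chain, one holding the tail of [s] and the other its head, the larger
    holds both. Asking for [X0] inside [X] settles the empty list and later shows that [X] is
    nonempty. *)
Lemma total_on_bigcup_seq {T : eqType} {F : set (set T)} {X0 : set T}
    (s : seq T) :
  total_on F subset -> F X0 -> [set` s] `<=` \bigcup_(X in F) X ->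
  exists2 X, F X & X0 `<=` X /\ [set` s] `<=` X.
Proof.
move=> totF FX0; elim: s => [_|a s IHs sF]; first by exists X0; last by split.
have [|X FX [X0X sX]] := IHs.
  by move=> x xs; apply: sF; rewrite /mkset inE [x \in s]xs orbT.
have [|Y FY Ya] := sF a; first by rewrite /= inE eqxx.
have [XY|YX] := totF _ _ FX FY.
  exists Y => //; split=> [|x]; first exact: subset_trans XY.
  by rewrite /mkset inE => /predU1P[->//|/sX/XY].
exists X => //; split=> // x.
by rewrite /mkset inE => /predU1P[->|/sX//]; apply: YX.
Qed.

Lemma smallest_subgroup {G : groupType} (S : set G) :
  subgroup (smallest (@subgroup G) S).
Proof.
split=> [H [[]] //|x y Hx Hy H HS|x Hx H HS].
  by case: (HS) => -[_ HM _] _; apply: HM; [apply: Hx|apply: Hy].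
by case: (HS) => -[_ _ HV] _; apply: HV; apply: Hx.
Qed.

Lemma maximal_subgroup_exists {G : groupType} {H : set G} :
  finitely_generated G -> subgroup H -> H <> [set: G] ->
  exists2 M, maximal_subgroup M & H `<=` M.
Proof.
move=> [S /finite_seqP[s ->] genS] subH properH.
(* The alternative X = set0 makes the property hold for the empty chain. *)
pose P (X : set G) := X = set0 \/ [/\ subgroup X, X <> [set: G] & H `<=` X].
have [F FP totF|A [PA maxA]] := @Zorn_bigcup G P.
  have [[X0 FX0 X0n]|F0] := pselect (exists2 X, F X & X <> set0); last first.
    left; apply/seteqP; split=> // x [X FX Xx]; apply: F0.
    by exists X => // X0; rewrite X0 in Xx.
  have FQ X x : F X -> X x -> [/\ subgroup X, X <> [set: G] & H `<=` X].
    by move=> FX Xx; case: (FP _ FX) => // XE; rewrite XE in Xx.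
  have /set0P[x0 X0x0] : X0 != set0 by apply/eqP.
  have [[X01 _ _] _ HX0] := FQ _ _ FX0 X0x0.
  right; split; [split| |].
  - by exists X0.
  - move=> x y [X FX Xx] [Y FY Yy].
    have [XY|YX] := totF _ _ FX FY.
      have [[_ YM _] _ _] := FQ _ _ FY Yy.
      by exists Y => //; apply: YM => //; apply: XY.
    have [[_ XM _] _ _] := FQ _ _ FX Xx.
    by exists X => //; apply: XM => //; apply: YX.
  - move=> x [X FX Xx]; have [[_ _ XV] _ _] := FQ _ _ FX Xx.
    by exists X => //; apply: XV.
  (* If the union were [G], a single member of the chain would contain all the generators [s]. *)
  - move=> FT.
    have [|X FX [X0X sX]] := total_on_bigcup_seq s totF FX0; first by rewrite FT.
    have [subX + _] := FQ _ _ FX (X0X _ X01).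
    by apply; apply/seteqP; split=> // x; rewrite -genS; apply: smallest_sub.
  - by move=> x Hx; exists X0 => //; apply: HX0.
(* The maximal set is not empty, since [H] satisfies [P] and contains 1. *)
case: PA => [A0|[subA properA HA]].
  case: (maxA H); last by right; split.
  rewrite A0; split=> // H0; case: subH => H1 _ _.
  exact: (H0 _ H1).
exists A => //; split=> // K subK properK AK.
apply/seteqP; split=> // x Kx; apply: contrapT => nAx.
apply: (maxA K); first by split=> // KA; apply: nAx; apply: KA.
by right; split=> //; apply: subset_trans AK.
Qed.

(** * Commutators modulo a normal subgroup *)

Lemma normal_commg {G : groupType} {N : set G} (x y : G) :
  normal_subgroup N -> N y -> N [~ x, y].
Proof.
move=> [[_ NM NV] NJ] Ny.
by rewrite commgEr; apply: NM => //; apply: NJ; apply: NV.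
Qed.

Lemma normal_commg_sym {G : groupType} {N : set G} (x y : G) :
  normal_subgroup N -> N [~ x, y] -> N [~ y, x].
Proof.
move=> [[_ _ NV] _] /NV.
by rewrite /commg /conjg !invgM !invgK !mulgA.
Qed.

(** This is the preimage of the centralizer of the coset of [x]; commutator identities replace the
    passage to the quotient by [N]. *)
Lemma centralizer_mod_subgroup {G : groupType} {N : set G} (x : G) :
  normal_subgroup N -> subgroup [set y | N [~ x, y]].
Proof.
move=> [[N1 NM NV] NJ]; split=> [|y z /= Ny Nz|y /= Ny] /=.
- by rewrite commg1.
- have -> : [~ x, y * z] = [~ x, z] * [~ x, y] ^ z.
    by rewrite /commg /conjg !invgM !mulgA !mulgK.
  by apply: NM => //; apply: NJ.
- have -> : [~ x, y^-1] = ([~ x, y]^-1) ^ y^-1.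
    by rewrite /commg /conjg !invgM !invgK !mulgA mulgV mul1g.
  by apply: NJ; apply: NV.
Qed.

Lemma derived_sub {G : groupType} {N : set G} :
  subgroup N -> (forall x y, N [~ x, y]) -> @derived G `<=` N.
Proof. by move=> subN NR; apply: smallest_sub => // _ [x [y ->]]. Qed.

Lemma derived_sub_maximal {G : groupType} {M : set G} :
  maximal_subgroup M -> normal_subgroup M -> @derived G `<=` M.
Proof.
move=> [subM _ maxM] nM; apply: derived_sub => // x y.
have [CT|CM] := pselect ([set z | M [~ x, z]] = setT).
  by have : [set: G] y by []; rewrite -CT.
have subC := centralizer_mod_subgroup x nM.
have MC : M `<=` [set z | M [~ x, z]] by move=> z; apply: normal_commg.
(* The centralizer of [x] modulo [M] is now proper, hence equal to [M] by maximality; it contains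
   [x], so [x] lies in [M]. *)
apply: normal_commg_sym => //; apply: normal_commg => //.
by rewrite -(maxM _ subC CM MC) /= commgg; case: subM.
Qed.

Lemma derived_sub_generated {G : groupType} {n : nat} {U : n.-tuple G} {i : 'I_n}
    {N : set G} :
  normal_subgroup N -> (forall j, j != i -> N (tnth U j)) ->
  smallest (@subgroup G) [set x | x \in U] = [set: G] -> @derived G `<=` N.
Proof.
move=> nN NU genU; have [subN _] := nN.
have centralizer_full x : N [~ x, tnth U i] -> forall y, N [~ x, y].
  move=> Nxi y; have : [set: G] y by [].
  rewrite -genU; apply: (smallest_sub (centralizer_mod_subgroup x nN)).
  move=> _ /tnthP[j ->] /=; have [->//|ji] := eqVneq j i.
  by apply: normal_commg => //; apply: NU.
(* [centralizer_full] is used twice: [tnth U i] commutes with itself, so with every [x] modulo [N];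
   hence [x] commutes with everything modulo [N]. *)
apply: derived_sub => // x; apply: (centralizer_full x).
apply: normal_commg_sym => //; apply: centralizer_full.
by rewrite commgg; case: subN.
Qed.

(** * Generation of [G] and of its abelianization *)

Lemma normally_generating_sub {G : groupType} {n : nat} {U : n.-tuple G}
    {N : set G} :
  normal_subgroup N -> (forall i, N (tnth U i)) -> normally_generating U ->
  N = [set: G].
Proof.
move=> nN NU genU; apply/seteqP; split=> // x; rewrite -genU.
by apply: smallest_sub => // _ /tnthP[i ->].
Qed.

Lemma tnth_ab_tuple {G : groupType} {n : nat} (U : n.-tuple G) i :
  tnth (ab_tuple U) i = ab (tnth U i).
Proof. by rewrite /ab_tuple tnth_map. Qed.

Lemma ab_tuple_set_entry {G : groupType} {n : nat} (U : n.-tuple G) i y :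
  ab_tuple (set_entry U i y) = set_entry (ab_tuple U) i (ab y).
Proof.
apply: eq_from_tnth => k; rewrite tnth_ab_tuple !tnth_set_entry.
by case: eqP => // _; rewrite tnth_ab_tuple.
Qed.

(** Normal subgroups of [Ab G] pull back to normal subgroups of [G], and [ab] is surjective. *)
Lemma normally_generating_ab {G : groupType} {n : nat} {U : n.-tuple G} :
  normally_generating U -> normally_generating (ab_tuple U).
Proof.
move=> genU; apply/seteqP; split=> // a _ K [nK KU].
have [[K1 KM KV] KJ] := nK.
suff KT : [set x | K (ab x)] = [set: G].
  have : [set: G] (repr a) by []; rewrite -KT /=.
  by rewrite ab_reprK.
apply: normally_generating_sub genU.
  split; first split=> /=.
  - by rewrite gmulf1.
  - by move=> x y Kx Ky; rewrite gmulfM; apply: KM.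
  - by move=> x Kx; rewrite gmulfV; apply: KV.
  by move=> x g /= Kx; rewrite gmulfJ; apply: KJ.
by move=> i; apply: KU; rewrite /= -tnth_ab_tuple mem_tnth.
Qed.

Lemma image_ab_normal {G : groupType} {M : set G} :
  normal_subgroup M -> normal_subgroup (@ab G @` M).
Proof.
move=> [[M1 MM MV] MJ]; split; first split.
- by exists 1; rewrite ?gmulf1.
- by move=> _ _ [x Mx <-] [y My <-]; exists (x * y); [apply: MM|apply: gmulfM].
- by move=> _ [x Mx <-]; exists x^-1; [apply: MV|apply: gmulfV].
move=> _ a [x Mx <-]; exists (x ^ repr a); first exact: MJ.
by rewrite gmulfJ /= ab_reprK.
Qed.

(** Otherwise [U] lies in a maximal subgroup [M], which is normal and contains the derived subgroup.
    The image of [M] is all of [Ab G], which forces [M] to be [G]. *)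
Lemma ab_generating_generated {G : groupType} {n : nat} {U : n.-tuple G} :
  class_C G -> normally_generating (ab_tuple U) ->
  smallest (@subgroup G) [set x | x \in U] = [set: G].
Proof.
move=> [fgG maxG] genU; apply: contrapT => properU.
have [M maxM UM] := maximal_subgroup_exists fgG (smallest_subgroup _) properU.
have nM := maxG _ maxM; have DM := derived_sub_maximal maxM nM.
case: maxM => [[_ MM _] properM _]; apply: properM.
apply/seteqP; split=> // x _.
have abMT : @ab G @` M = [set: Ab G].
  apply: normally_generating_sub genU; first exact: image_ab_normal.
  move=> i; exists (tnth U i); last by rewrite tnth_ab_tuple.
  by apply: UM => H [_]; apply; rewrite /= mem_tnth.
have : [set: Ab G] (ab x) by [].
rewrite -abMT => -[m Mm /ab_eqP Dmx].
by rewrite -(mulVKg m x); apply: MM => //; apply: DM.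
Qed.

Lemma generated_normally_generating {G : groupType} {n : nat} {U : n.-tuple G} :
  smallest (@subgroup G) [set x | x \in U] = [set: G] -> normally_generating U.
Proof.
move=> genU; apply/seteqP; split=> // x _ H [[subH _] UH].
suff : [set: G] x by rewrite -genU; apply.
by [].
Qed.

(** * Correcting entries by elements of the derived subgroup *)

Lemma AC_equiv_mul_entry {G : groupType} {n : nat} {U : n.-tuple G} (i : 'I_n)
    {c : G} :
  smallest (@subgroup G) [set x | x \in U] = [set: G] -> derived c ->
  AC_equiv U (set_entry U i (tnth U i * c)).
Proof.
move=> genU Dc.
have setU : set_entry U i (tnth U i) = U.
  by apply: eq_from_tnth => k; rewrite tnth_set_entry; case: eqP => // ->.
(* Letting [x] range over all of [G] makes [K] closed under products, by composing chains, and under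
   inverses, by starting at [x * d^-1]. *)
pose K := [set d | forall x,
  AC_equiv (set_entry U i x) (set_entry U i (x * d))].
have set_set x y : set_entry (set_entry U i x) i y = set_entry U i y.
  by apply: eq_from_tnth => k; rewrite !tnth_set_entry; case: eqP.
have conjK x g : AC_equiv (set_entry U i x) (set_entry U i (x ^ g)).
  apply: rt_step; rewrite -(set_set x (x ^ g)).
  move: (AC_conj (set_entry U i x) i g); by rewrite tnth_set_entry eqxx.
suff DK : @derived G `<=` K by rewrite -{1}setU; apply: DK.
apply: (derived_sub_generated (i := i)) genU => [|j ji].
  split; first split.
  - by move=> x; rewrite mulg1; apply: rt_refl.
  - move=> d e Kd Ke x; apply: rt_trans (Kd x) _.
    by rewrite mulgA; apply: Ke.
  - move=> d Kd x; apply: AC_equiv_sym.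
    by move: (Kd (x * d^-1)); rewrite mulgVK.
  (* Conjugate by [g^-1], multiply by [d], conjugate by [g]: the result is [x * d ^ g]. *)
  move=> d g Kd x; apply: rt_trans (conjK x g^-1) _.
  apply: rt_trans (Kd _) _.
  move: (conjK (x ^ g^-1 * d) g); by rewrite conjMg conjgKV.
have ij : i != j by rewrite eq_sym.
move=> x; apply/rt_step/AC_nielsen; rewrite -(set_set x (_ * _)).
move: (NielsenR (set_entry U i x) ij).
by rewrite !tnth_set_entry eqxx (negbTE ji).
Qed.

Lemma AC_equiv_same_ab {G : groupType} {n : nat} {U V : n.-tuple G} :
  class_C G -> normally_generating U -> ab_tuple U = ab_tuple V ->
  AC_equiv U V.
Proof.
move=> CG genU UV.
have abUV i : ab (tnth U i) = ab (tnth V i) by rewrite -!tnth_ab_tuple UV.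
(* [W k] interpolates from [U] to [V]. Every [W k] has the same image in [Ab G], hence generates
   [G], so that the correction applies at each stage. *)
pose W k : n.-tuple G := [tuple if (i < k)%N then tnth V i else tnth U i | i < n].
have -> : V = W n.
  by apply: eq_from_tnth => i; rewrite tnth_mktuple ltn_ord.
suff UW k : (k <= n)%N -> AC_equiv U (W k) by apply: UW.
elim: k => [_|k IHk kn].
  suff -> : W 0%N = U by apply: rt_refl.
  by apply: eq_from_tnth => i; rewrite tnth_mktuple.
apply: rt_trans (IHk (ltnW kn)) _.
pose i := Ordinal kn.
have -> : W k.+1 = set_entry (W k) i (tnth (W k) i * ((tnth U i)^-1 * tnth V i)).
  apply: eq_from_tnth => j.
  rewrite tnth_set_entry !tnth_mktuple ltnn mulVKg ltnS leq_eqVlt -val_eqE /=.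
  have [jk|//] := eqVneq (j : nat) k.
  by congr tnth; apply: val_inj.
apply: AC_equiv_mul_entry; last by apply/ab_eqP.
apply: ab_generating_generated => //.
suff -> : ab_tuple (W k) = ab_tuple U by apply: normally_generating_ab.
apply: eq_from_tnth => j; rewrite !tnth_ab_tuple tnth_mktuple.
by case: ifP.
Qed.

(** * Transfer of AC-moves between [G] and [Ab G] *)

Lemma AC_move_lift {G : groupType} {n : nat} {U : n.-tuple G}
    {B : n.-tuple (Ab G)} :
  AC_move (ab_tuple U) B -> exists2 V, AC_move U V & ab_tuple V = B.
Proof.
case=> [_ [i j ij|i j ij|i j ij|i j ij|j]|i a].
- exists (set_entry U i (tnth U i * tnth U j)); first exact/AC_nielsen/NielsenR.
  by rewrite ab_tuple_set_entry !tnth_ab_tuple gmulfM.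
- exists (set_entry U i (tnth U i * (tnth U j)^-1)).
    exact/AC_nielsen/NielsenRV.
  by rewrite ab_tuple_set_entry !tnth_ab_tuple gmulfM gmulfV.
- exists (set_entry U i (tnth U j * tnth U i)); first exact/AC_nielsen/NielsenL.
  by rewrite ab_tuple_set_entry !tnth_ab_tuple gmulfM.
- exists (set_entry U i ((tnth U j)^-1 * tnth U i)).
    exact/AC_nielsen/NielsenLV.
  by rewrite ab_tuple_set_entry !tnth_ab_tuple gmulfM gmulfV.
- exists (set_entry U j (tnth U j)^-1); first exact/AC_nielsen/NielsenI.
  by rewrite ab_tuple_set_entry !tnth_ab_tuple gmulfV.
exists (set_entry U i (tnth U i ^ repr a)); first exact: AC_conj.
by rewrite ab_tuple_set_entry !tnth_ab_tuple gmulfJ /= ab_reprK.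
Qed.

Lemma AC_equiv_lift {G : groupType} {n : nat} {U : n.-tuple G}
    {B : n.-tuple (Ab G)} :
  AC_equiv (ab_tuple U) B -> exists2 V, AC_equiv U V & ab_tuple V = B.
Proof.
(* Naming the starting tuple [A] lets the induction range over all its lifts [U], as the second half
   of a chain starts at whichever lift the first half reached. *)
move=> UB; have [A defA] : exists A, ab_tuple U = A by exists (ab_tuple U).
rewrite defA in UB.
elim: UB U defA => {A B} [A B AB|A|A B C _ IHAB _ IHBC] U UA.
- move: AB; rewrite -UA => /AC_move_lift[V UV VB].
  by exists V => //; apply: rt_step.
- by exists U => //; apply: rt_refl.
have [V UV /IHBC[W VW WC]] := IHAB _ UA.
by exists W => //; apply: rt_trans UV VW.
Qed.

Lemma AC_move_ab {G : groupType} {n : nat} {U V : n.-tuple G} :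
  AC_move U V -> AC_move (ab_tuple U) (ab_tuple V).
Proof.
case=> [_ [i j ij|i j ij|i j ij|i j ij|j]|i s];
  rewrite ab_tuple_set_entry ?gmulfM ?gmulfV ?gmulfJ /= -!tnth_ab_tuple.
- exact/AC_nielsen/NielsenR.
- exact/AC_nielsen/NielsenRV.
- exact/AC_nielsen/NielsenL.
- exact/AC_nielsen/NielsenLV.
- exact/AC_nielsen/NielsenI.
exact: AC_conj.
Qed.

Lemma AC_equiv_ab {G : groupType} {n : nat} {U V : n.-tuple G} :
  AC_equiv U V -> AC_equiv (ab_tuple U) (ab_tuple V).
Proof.
elim=> [A B /AC_move_ab AB|A|A B C _ AB _ BC]; first exact: rt_step.
  exact: rt_refl.
exact: rt_trans AB BC.
Qed.

(** A chain lifted from [U] ends at some [W] with the same image as [V]; correcting entries then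
    joins [V] to [W]. *)
Lemma AC_equiv_ab_iff {G : groupType} {n : nat} {U V : n.-tuple G} :
  class_C G -> normally_generating V ->
  AC_equiv U V <-> AC_equiv (ab_tuple U) (ab_tuple V).
Proof.
move=> CG genV; split=> [|/AC_equiv_lift[W UW WV]]; first exact: AC_equiv_ab.
by apply: rt_trans UW _; apply/AC_equiv_sym/AC_equiv_same_ab.
Qed.

(** * Components of the AC-graphs *)

Lemma AC_move_normal_sub {G : groupType} {n : nat} {U V : n.-tuple G}
    {N : set G} :
  AC_move U V -> normal_subgroup N -> (forall i, N (tnth U i)) ->
  forall i, N (tnth V i).
Proof.
move=> UV [[N1 NM NV] NJ] NU k.
by case: UV => [_ []|] *; rewrite tnth_set_entry; case: ifP => _ //;
  do ?[exact: NU|apply: NJ|apply: NV|apply: NM].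
Qed.

(** By the inverse move, a normal subgroup containing the entries of [V] contains those of [U]. *)
Lemma AC_move_normally_generating {G : groupType} {n : nat} {U V : n.-tuple G} :
  AC_move U V -> normally_generating U -> normally_generating V.
Proof.
move=> /AC_move_sym VU genU; apply/seteqP; split=> // x _ N [nN VN].
suff -> : N = [set: G] by [].
apply: normally_generating_sub genU => //.
by apply: AC_move_normal_sub VU nN _ => i; apply: VN; rewrite /= mem_tnth.
Qed.

(** AC-moves preserve normal generation, so a chain of moves starting at a vertex never leaves the
    graph. *)
Lemma component_AC_equiv {G : groupType} {n : nat} {U : n.-tuple G} :
  normally_generating U ->
  [set V | AC_vertex V /\ clos_refl_trans _ (@AC_edge G n) U V] =
  [set V | normally_generating V /\ AC_equiv U V].
Proof.
move=> genU; apply/seteqP; split=> V /= [genV UV]; split=> //.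
  elim: UV {genU genV} => [A B [_ _ [AB|/AC_move_sym AB]]|A|A B C _ AB _ BC].
  - exact: rt_step.
  - exact: rt_step.
  - exact: rt_refl.
  - exact: rt_trans AB BC.
suff [] : normally_generating V /\ clos_refl_trans _ (@AC_edge G n) U V by [].
elim: UV genU {genV} => [A B AB|A|A B C _ IHAB _ IHBC] genA.
- have genB := AC_move_normally_generating AB genA.
  by split=> //; apply: rt_step; split=> //; left.
- by split=> //; apply: rt_refl.
have [genB AB] := IHAB genA; have [genC BC] := IHBC genB.
by split=> //; apply: rt_trans AB BC.
Qed.

Lemma ab_preimage_component {G : groupType} {n : nat} {U : n.-tuple G} :
  class_C G -> normally_generating U ->
  ab_preimage [set B | AC_vertex B /\
    clos_refl_trans _ (@AC_edge (Ab G) n) (ab_tuple U) B] =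
  [set V | AC_vertex V /\ clos_refl_trans _ (@AC_edge G n) U V].
Proof.
move=> CG genU; rewrite !component_AC_equiv //; last exact: normally_generating_ab.
apply/seteqP; split=> V /=.
  by move=> [genV [_ UV]]; split=> //; apply/AC_equiv_ab_iff.
move=> [genV UV]; split=> //; split; first exact: normally_generating_ab.
exact: AC_equiv_ab.
Qed.

(** Any choice of representatives works. This ensures that every component for [Ab G] has a nonempty
    preimage. *)
Lemma normally_generating_lift {G : groupType} {n : nat}
    {B : n.-tuple (Ab G)} :
  class_C G -> normally_generating B ->
  exists2 U : n.-tuple G, normally_generating U & ab_tuple U = B.
Proof.
move=> CG genB; pose U : n.-tuple G := [tuple repr (tnth B i) | i < n].
have UB : ab_tuple U = B.
  by apply: eq_from_tnth => i; rewrite tnth_ab_tuple tnth_mktuple ab_reprK.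
exists U => //; apply: generated_normally_generating.
by apply: ab_generating_generated => //; rewrite UB.
Qed.

Theorem theorem1p3 (G : groupType) (n : nat) (hG : class_C G)
    (n_gt0 : (0 < n)%N) (hn : (weight G <= n)%N) :
  (forall U V : n.-tuple G,
     normally_generating U -> normally_generating V ->
     (AC_equiv U V <-> AC_equiv (ab_tuple U) (ab_tuple V))) /\
  AC_components G n =
    [set ab_preimage C | C in AC_components (Ab G) n].
Proof.
split=> [U V _ genV|]; first exact: AC_equiv_ab_iff.
apply/seteqP; split=> [_ [U genU <-]|_ [_ [B genB <-] <-]].
  rewrite -ab_preimage_component //; eexists; last by [].
  by exists (ab_tuple U) => //; apply: normally_generating_ab.
(* A lift of the base point [B] serves as base point of the component in [G]. *)
have [U genU <-] := normally_generating_lift hG genB.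
by exists U => //; rewrite ab_preimage_component.
Qed.
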